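(* Let $\Delta>0$ and let $G$ be the linear network (path) with $n$ users, with i.i.d. edge weights uniform on $\{1,1+\Delta\}$ and i.i.d. user quantities uniform on $\{1,2\}$ (independent of the weights). Then the average performance ratio achieved by the multi-unit version of Algorithm 1 (greedy allocation) satisfies $$\lim_{n\to\infty}PR(G)\;\ge\;\frac{0.604+0.433\,\Delta}{0.75+0.5\,\Delta}.$$ This lower bound on the ratio increases with $\Delta$ and is larger than $80.5\%$ even when $\Delta\to0^+$.
   Context: Linear network: users $u_1,\dots,u_n$, edges $e_i=\{u_i,u_{i+1}\}$ for $i=1,\dots,n-1$, with weight $w_{i,i+1}$ on $e_i$. User $u_i$ has quantity $q_i$ (a positive integer); $W$ and $Q$ denote the vectors of weights and quantities. Multi-unit allocation problem: maximize $\sum_{i=1}^{n-1}w_{i,i+1}x_{i,i+1}$ over nonnegative integers $x_{i,i+1}$ subject to $x_{i-1,i}+x_{i,i+1}\le q_i$ for $2\le i\le n-1$, $x_{1,2}\le q_1$, $x_{n-1,n}\le q_n$. Its optimal value is $f^\star(G,W,Q)$. Multi-unit version of Algorithm 1 (greedy allocation): initially all $x_{i,i+1}=0$ and each user's remaining quantity is $q_i$; a user is available while its remaining quantity is positive. Each iteration has two phases. Proposal phase: every available user having at least one available neighbor sends a proposal to the available neighbor to which it is joined by the edge of largest weight (if its two edges have the same weight, the left neighbor has priority). Matching phase: for every pair $u_i,u_{i+1}$ that proposed to each other, $x_{i,i+1}$ is increased by the minimum of the two remaining quantities, and both remaining quantities are decreased by the same amount. The algorithm stops when no available user has an available neighbor.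 Its total weight $\sum_i w_{i,i+1}x_{i,i+1}$ is $\hat f(G,W,Q)$. The average performance ratio is $PR(G)=\mathbb{E}_{W,Q}[\hat f(G,W,Q)]/\mathbb{E}_{W,Q}[f^\star(G,W,Q)]$. *)

(* Defs.v *)
From HB Require Import structures.
From mathcomp Require Import all_boot all_order all_algebra.
From mathcomp Require Import all_classical all_reals all_analysis.

Set Implicit Arguments.
Unset Strict Implicit.
Unset Printing Implicit Defensive.

Import Order.TTheory GRing.Theory Num.Theory.
Import numFieldNormedType.Exports.

Local Open Scope classical_set_scope.
Local Open Scope ring_scope.

(* MathComp-Analysis.  In the linear network with n users, the users are      *)
(* indexed from 0 by 'I_n and the edges by 'I_n.-1: edge e joins the users e  *)
(* and e + 1.                                                                 *)

Section LinearNetwork.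
Context (R : realType) (n : nat).
Implicit Types (w : 'I_n.-1 -> R) (q : 'I_n -> nat) (x : {ffun 'I_n.-1 -> nat}).
Implicit Types (i : 'I_n) (e : 'I_n.-1).

Definition left_end e : 'I_n := widen_ord (leq_pred n) e.

Fact right_end_subproof e : (e.+1 < n)%N.
Proof. by rewrite -ltn_predRL. Qed.

Definition right_end e : 'I_n := Ordinal (right_end_subproof e).

Definition incident i e := (i == left_end e) || (i == right_end e).

Definition load x i : nat := (\sum_(e | incident i e) x e)%N.

Definition feasible q x : Prop := forall i, (load x i <= q i)%N.

Definition total_weight w x : R := \sum_e w e * (x e)%:R.

(* The set below is finite and contains the value of the zero allocation, so  *)
(* that its supremum is a maximum.                                            *)
Definition fstar w q : R :=
  sup [set total_weight w x | x in [set x | feasible q x]].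

(* Every unit allocated on an edge consumes one unit of both its end users.   *)
Definition remaining q x i : nat := (q i - load x i)%N.

Definition available q x i : bool := (0 < remaining q x i)%N.

Definition live q x e : bool :=
  available q x (left_end e) && available q x (right_end e).

(* At most one edge is proposed along by i, since i has at most two edges; of *)
(* two edges incident to i, the one with the smaller index leads to the left  *)
(* neighbor, which has priority in case of equal weights.                     *)
Definition proposes w q x i e : bool :=
  [&& incident i e, live q x e &
      [forall e', incident i e' && live q x e' ==>
         (w e' < w e) || (w e' == w e) && (e <= e')%N]].

Definition matched w q x e : bool :=
  proposes w q x (left_end e) e && proposes w q x (right_end e) e.

Definition greedy_step w q x : {ffun 'I_n.-1 -> nat} :=
  [ffun e => (x e + (if matched w q x e
                     then minn (remaining q x (left_end e))
                               (remaining q x (right_end e))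
                     else 0))%N].

Definition halted q x : bool := [forall e, ~~ live q x e].

(* n iterations always reach the stopping condition (halted_greedy), and      *)
(* further iterations would not change the allocation (greedy_step_halted).   *)
Definition greedy w q : {ffun 'I_n.-1 -> nat} :=
  iter n (greedy_step w q) [ffun=> 0%N].

Definition fhat w q : R := total_weight w (greedy w q).

Lemma greedy_step_halted w q x : halted q x -> greedy_step w q x = x.
Proof.
move=> /forallP hx; apply/ffunP => e; rewrite ffunE.
by rewrite /matched /proposes (negbTE (hx e)) !andbF addn0.
Qed.

Lemma leq_greedy_step w q x e : (x e <= greedy_step w q x e)%N.
Proof. by rewrite ffunE leq_addr. Qed.

Lemma remaining_step w q x i :
  (remaining q (greedy_step w q x) i <= remaining q x i)%N.
Proof.
by apply: leq_sub2l; apply: leq_sum => e _; exact: leq_greedy_step.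
Qed.

Lemma remaining_matched w q x i e : incident i e ->
  (remaining q (greedy_step w q x) i
     <= remaining q x i - (greedy_step w q x e - x e))%N.
Proof.
move=> ie; rewrite /remaining -subnDA; apply: leq_sub2l.
rewrite /load (bigD1 e) //= [leqRHS](bigD1 e) //= addnC addnA.
rewrite subnK ?leq_greedy_step// leq_add2l.
by apply: leq_sum => e' _; exact: leq_greedy_step.
Qed.

Lemma exists_matched w q x : ~~ halted q x ->
  exists e, live q x e && matched w q x e.
Proof.
rewrite negb_forall => /existsP[e0]; rewrite negbK => le0.
case: (arg_maxP w le0) => e1 le1 e1max.
pose p := [pred e | live q x e && (w e == w e1)].
have Pe1 : p e1 by rewrite /= le1 eqxx.
case: (arg_minnP (fun e : 'I_n.-1 => e : nat) Pe1) => e /andP[le /eqP we] emin.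
have best e' : live q x e' -> (w e' < w e) || (w e' == w e) && (e <= e')%N.
  move=> le'; have := e1max _ le'.
  rewrite /= -we le_eqVlt => /orP[/eqP we'|->//].
  by rewrite we' eqxx emin ?orbT//= le' we' we eqxx.
exists e; rewrite le /matched /proposes /incident le !eqxx orbT /=.
by apply/andP; split; apply/forallP => e'; apply/implyP => /andP[_ /best].
Qed.

Lemma card_available_step w q x : ~~ halted q x ->
  (#|available q (greedy_step w q x)| < #|available q x|)%N.
Proof.
move=> /(exists_matched w)[e /andP[/andP[al ar] me]].
apply/proper_card/properP; split.
  by apply/fintype.subsetP => i /leq_trans; apply; exact: remaining_step.
have sub i : incident i e -> (remaining q x i <=
    minn (remaining q x (left_end e)) (remaining q x (right_end e)))%N ->
    ~~ available q (greedy_step w q x) i.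
  move=> ie le_i; rewrite -leqNgt (leq_trans (remaining_matched w q x ie))//.
  by rewrite ffunE me addKn leqn0 subn_eq0.
have [lr|/ltnW rl] := leqP (remaining q x (left_end e)) (remaining q x (right_end e)).
- by exists (left_end e) => //; apply: sub; rewrite ?leq_min ?leqnn// /incident eqxx.
- exists (right_end e) => //; apply: sub; rewrite ?leq_min ?leqnn ?rl//.
  by rewrite /incident eqxx orbT.
Qed.

Lemma halted_greedy w q : halted q (greedy w q).
Proof.
rewrite /greedy; set x0 := finfun _.
have H k : halted q (iter k (greedy_step w q) x0) ||
           (#|available q (iter k (greedy_step w q) x0)| + k <= n)%N.
  elim: k => [|k IH] /=.
    by rewrite addn0 (leq_trans (max_card _)) ?card_ord ?orbT.
  have [h|h] := boolP (halted q (iter k (greedy_step w q) x0)).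
    by rewrite greedy_step_halted ?h.
  rewrite (negbTE h) /= in IH; rewrite addnS (leq_trans _ IH) ?orbT//.
  by rewrite ltn_add2r card_available_step.
have /orP[//|] := H n; rewrite -[leqRHS]add0n leq_add2r leqn0 => /eqP/card0_eq c0.
apply/forallP => e; rewrite negb_and.
by have := c0 (left_end e); rewrite inE /in_mem /= => ->.
Qed.

End LinearNetwork.

Section Randomness.
Context d (T : measurableType d) (R : realType) (P : probability T R).

(* Mutual independence of a finite family of random variables, possibly with  *)
(* different codomains, given through the families of events they define.     *)
Definition mutually_independent (I : finType) (F : I -> set (set T)) : Prop :=
  forall (J : {set I}) (E : I -> set T), (forall i, i \in J -> F i (E i)) ->
    P (\bigcap_(i in [set` J]) E i) = (\prod_(i in J) P (E i))%E.

Definition events d' (T' : measurableType d') (X : T -> T') : set (set T) :=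
  preimage_set_system setT X measurable.

Definition uniform_on (T' : eqType) (s : seq T') (X : T -> T') : Prop :=
  uniq s /\ forall a, a \in s -> P (X @^-1` [set a]) = ((size s)%:R^-1)%:E.

Definition random_instance (n : nat) (Delta : R)
    (W : 'I_n.-1 -> {RV P >-> R}) (Q : 'I_n -> {RV P >-> nat}) : Prop :=
  [/\ forall e, uniform_on [:: 1; 1 + Delta] (W e),
      forall i, uniform_on [:: 1%N; 2%N] (Q i) &
      mutually_independent (fun k : 'I_n.-1 + 'I_n =>
        match k with inl e => events (W e) | inr i => events (Q i) end)].

Definition PR (n : nat)
    (W : 'I_n.-1 -> {RV P >-> R}) (Q : 'I_n -> {RV P >-> nat}) : R :=
  fine 'E_P[fun t => fhat (fun e => W e t) (fun i => Q i t)] /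
  fine 'E_P[fun t => fstar (fun e => W e t) (fun i => Q i t)].

End Randomness.

Definition ratio_bound (R : realType) (Delta : R) : R :=
  (604 / 1000 + 433 / 1000 * Delta) / (75 / 100 + 1 / 2 * Delta).

(* Main.v *)
Require Import Defs.
From HB Require Import structures.
From mathcomp Require Import all_boot all_order all_algebra.
From mathcomp Require Import all_classical all_reals all_analysis measurable_realfun.
From mathcomp Require Import ring lra zify.

Import Order.TTheory GRing.Theory Num.Theory.
Import numFieldNormedType.Exports.

Local Open Scope classical_set_scope.
Local Open Scope ring_scope.

Set Implicit Arguments.
Unset Strict Implicit.
Unset Printing Implicit Defensive.

(** The greedy allocation is characterized locally: each edge exhausts one of
    its ends once the edges of higher priority (heavier, or equally heavy and
    further left) have been served.  Hence heavy edges are filled from left to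
    right and then light edges from left to right, so that the greedy amounts
    are the output of a finite automaton reading the i.i.d. weights and
    quantities with a lookahead of one.  Explicit solutions of the Poisson
    equation of the corresponding Markov chain give E[fhat] = n rho + O(1) with
    rho = 232/361 + 17/38 Delta.  On the other hand E[fstar] is superadditive
    in n, so that E[fstar]/n converges by Fekete's lemma, and fstar is at most
    half the total quantity plus Delta times the largest possible amount on
    heavy edges; the greedy allocation achieves the latter, whence
    lim E[fstar]/n <= 3/4 + 17/38 Delta. *)

(** * The greedy allocation in terms of edge priorities *)

Section Greedy.
Context (R : realType) (n : nat) (w : 'I_n.-1 -> R) (q : 'I_n -> nat).
Implicit Types (x : {ffun 'I_n.-1 -> nat}) (i : 'I_n) (e f : 'I_n.-1).

(** A strict total order on the edges. On the edges at one user it is the order in which that user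
    prefers them, hence the tie-break by the smaller index. *)
Definition prec e f : bool := (w f < w e) || (w e == w f) && (e < f)%N.

Definition higher_load x e i : nat :=
  (\sum_(f | incident i f && prec f e) x f)%N.

Lemma incidentP i e :
  incident i e -> i = left_end e \/ i = right_end e.
Proof. by move=> /orP[/eqP|/eqP]; [left|right]. Qed.

Lemma incident_left e : incident (left_end e) e.
Proof. by rewrite /incident eqxx. Qed.

Lemma incident_right e : incident (right_end e) e.
Proof. by rewrite /incident eqxx orbT. Qed.

Lemma matched_proposes x e i : matched w q x e -> incident i e ->
  proposes w q x i e.
Proof. by move=> /andP[? ?] /incidentP[]->. Qed.

Lemma matched_live x e : matched w q x e -> live q x e.
Proof. by move=> /andP[/and3P[]]. Qed.

Lemma matched_prec x e f i : matched w q x f -> incident i f ->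
  live q x e -> incident i e -> e != f -> prec f e.
Proof.
move=> mf if_ le ie ne; have /and3P[_ _ /forallP/(_ e)] := matched_proposes mf if_.
rewrite ie le /= /prec => /orP[->//|/andP[/eqP-> fe]].
by rewrite eqxx ltn_neqAle fe andbT val_eqE eq_sym ne orbT.
Qed.

Lemma prec_asym e f : prec e f -> ~~ prec f e.
Proof.
rewrite /prec negb_or -leNgt negb_and -leqNgt.
move=> /orP[lt|/andP[/eqP-> lt]]; first by rewrite (ltW lt) (lt_eqF lt).
by rewrite lexx eqxx /= ltnW.
Qed.

(** Two edges matched at the same user would each have priority over the other. So at most one
    increment counts for [i], and it is a minimum of which one term is the quantity remaining at
    [i]. *)
Lemma load_step_le x i :
  (load x i <= q i)%N -> (load (greedy_step w q x) i <= q i)%N.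
Proof.
move=> lq.
have -> : load (greedy_step w q x) i = (load x i +
   \sum_(e | incident i e && matched w q x e)
     minn (remaining q x (left_end e)) (remaining q x (right_end e)))%N.
  rewrite big_mkcondr /load -big_split /=.
  by apply: eq_bigr => e _; rewrite ffunE.
rewrite -[leqRHS](subnKC lq) leq_add2l.
have [/existsP[e /andP[ie me]]|/existsPn h] :=
  boolP [exists e, incident i e && matched w q x e]; last first.
  by rewrite big_pred0// => e; apply/negbTE/h.
rewrite (big_pred1 e) => [|f]; last first.
  apply/idP/eqP => [/andP[jf mf]|->]; last by rewrite /= ie.
  apply/eqP; apply: contraT => ne.
  have := matched_prec me ie (matched_live mf) jf ne.
  move=> /prec_asym; rewrite (matched_prec mf jf (matched_live me) ie)//.
  by rewrite eq_sym.
by rewrite geq_min; have [->|->] := incidentP ie; rewrite leqnn ?orbT.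
Qed.

Lemma live_step x e : live q (greedy_step w q x) e -> live q x e.
Proof.
move=> /andP[l r]; apply/andP; split.
- exact: leq_trans l (remaining_step _ _ _ _).
- exact: leq_trans r (remaining_step _ _ _ _).
Qed.

Lemma matched_dies x e : matched w q x e -> ~~ live q (greedy_step w q x) e.
Proof.
move=> me; have rm i (ie : incident i e) := remaining_matched w q x ie.
have := rm _ (incident_left e); have := rm _ (incident_right e).
rewrite ffunE me addKn /live /available negb_and -!leqNgt; lia.
Qed.

(** By the second clause, which covers [f = e], the ends of a live edge are loaded only by edges of
    higher priority. This yields the third clause at the moment when the edge dies. *)
Definition greedy_invariant x : Prop :=
  [/\ feasible q x,
      forall e, live q x e -> forall i f,
        incident i e -> incident i f -> ~~ prec f e -> x f = 0%N &
      forall e, ~~ live q x e ->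
        exists2 i, incident i e & (q i <= x e + higher_load x e i)%N].

Lemma load_higher x e i :
  (forall f, incident i f -> ~~ prec f e -> x f = 0%N) ->
  load x i = higher_load x e i.
Proof.
move=> x0; rewrite /load /higher_load big_mkcondr; apply: eq_bigr => f jf.
by case: ifPn => // /(x0 _ jf).
Qed.

Lemma greedy_invariant_step x :
  greedy_invariant x -> greedy_invariant (greedy_step w q x).
Proof.
move=> [xq x0 xmin]; set y := greedy_step w q x.
(* An edge matched at an end of the live edge [e] was preferred to [e] there, so it has priority
   over [e]. *)
have y0 e i f : live q x e -> ~~ matched w q x e ->
    incident i e -> incident i f -> ~~ prec f e -> y f = 0%N.
  move=> le me ie jf pf; rewrite ffunE (x0 e le i f ie jf pf).
  case: ifPn => // mf; have [ef|ne] := eqVneq e f; first by rewrite ef mf in me.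
  by rewrite (matched_prec mf jf le ie ne) in pf.
have hl e i : (higher_load x e i <= higher_load y e i)%N.
  by apply: leq_sum => f _; exact: leq_greedy_step.
split.
- by move=> i; exact: load_step_le.
- move=> e le i f; apply: y0; first exact: live_step.
  by apply: contraL le => /matched_dies.
move=> e dy; have [le|] := boolP (live q x e); last first.
  move=> /xmin[i ie qi]; exists i => //; apply: leq_trans qi _.
  by rewrite leq_add ?leq_greedy_step.
have [me|me] := boolP (matched w q x e).
  (* The end with less left is exhausted by [e] itself, its earlier load being entirely of higher
     priority. *)
  have /orP[mi|mi] : (remaining q x (left_end e) <= remaining q x (right_end e))%N
     || (remaining q x (right_end e) <= remaining q x (left_end e))%N.
    exact: leq_total.
  - exists (left_end e); first exact: incident_left.
    rewrite ffunE me (minn_idPl mi) /remaining.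
    rewrite (load_higher (x0 e le _ ^~ (incident_left e))).
    have := hl e (left_end e); lia.
  - exists (right_end e); first exact: incident_right.
    rewrite ffunE me (minn_idPr mi) /remaining.
    rewrite (load_higher (x0 e le _ ^~ (incident_right e))).
    have := hl e (right_end e); lia.
(* Here [e] dies unmatched: one of its ends has been exhausted by edges of higher priority alone. *)
have [i ie] : exists2 i, incident i e & ~~ available q y i.
  move: dy; rewrite negb_and => /orP[]; 
    [exists (left_end e)|exists (right_end e)] => //.
    exact: incident_left.
  exact: incident_right.
rewrite -leqNgt leqn0 subn_eq0 => qi; exists i => //.
rewrite -(load_higher (fun f => y0 e i f le me ie)).
exact: leq_trans qi (leq_addl _ _).
Qed.

Lemma greedy_invariant0 : greedy_invariant [ffun=> 0%N].
Proof.
have l0 i : load [ffun=> 0%N] i = 0%N.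
  by rewrite /load big1 // => e _; rewrite ffunE.
split => [i|e _ i f _ _ _|e]; rewrite ?l0 ?ffunE//.
rewrite /live /available /remaining !l0 !subn0 negb_and -!leqNgt !leqn0.
move=> /orP[/eqP q0|/eqP q0]; [exists (left_end e)|exists (right_end e)];
  by rewrite ?q0 ?incident_left ?incident_right.
Qed.

Lemma greedy_invariant_greedy : greedy_invariant (greedy w q).
Proof.
rewrite /greedy; elim: (X in iter X) => [|k IH]; first exact: greedy_invariant0.
exact: greedy_invariant_step.
Qed.

Lemma greedy_feasible : feasible q (greedy w q).
Proof. by case: greedy_invariant_greedy. Qed.

Lemma greedy_exhausts e : exists2 i, incident i e &
  (q i <= greedy w q e + higher_load (greedy w q) e i)%N.
Proof.
case: greedy_invariant_greedy => _ _; apply.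
by have /forallP := halted_greedy w q.
Qed.

End Greedy.

(** * Allocations as sequences, and the optimum of a path *)

Definition before (x : nat -> nat) (i : nat) : nat :=
  if i is j.+1 then x j else 0%N.

Definition extend (N : nat) (x : 'I_N -> nat) (k : nat) : nat :=
  if insub k is Some e then x e else 0%N.

Lemma extend_ord N (x : 'I_N -> nat) (e : 'I_N) : extend x e = x e.
Proof. by rewrite /extend valK. Qed.

Lemma extend_out N (x : 'I_N -> nat) k : (N <= k)%N -> extend x k = 0%N.
Proof. by move=> Nk; rewrite /extend insubF// ltnNge Nk. Qed.

Lemma sum_extend N (x : 'I_N -> nat) k :
  (\sum_(e < N | val e == k) x e)%N = extend x k.
Proof.
rewrite /extend; case: insubP => [e _ <-|kN]; first by rewrite (big_pred1 e).
by rewrite big_pred0// => e; apply/eqP => ek; rewrite -ek ltn_ord in kN.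
Qed.

Lemma sum_incident N (x : 'I_N.+1.-1 -> nat) (i : 'I_N.+1) :
  (\sum_(e | incident i e) x e)%N = (before (extend x) i + extend x i)%N.
Proof.
rewrite (bigID (fun e : 'I_N.+1.-1 => val e == i)) /= addnC; congr (_ + _)%N.
  case: i => [[|j] ij]; rewrite /= /incident -?[i == _]val_eqE /=.
    by rewrite big_pred0// => e; rewrite -!val_eqE /= orbF eq_sym andbN.
  rewrite -[RHS]sum_extend; apply: eq_bigl => e.
  rewrite -!val_eqE /= eqSS; lia.
rewrite -[RHS]sum_extend; apply: eq_bigl => e; rewrite /incident -!val_eqE /=; lia.
Qed.

(** A path with [N] edges has [N.+1] users. The value 0 outside the path gives the two end users a
    constraint of the same form as that of the inner users. *)
Definition path_feasible (N : nat) (q x : nat -> nat) : Prop :=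
  (forall i, (i <= N)%N -> (before x i + x i <= q i)%N) /\
  (forall k, (N <= k)%N -> x k = 0%N).

Definition path_weight (R : realType) (N : nat) (w : nat -> R) (x : nat -> nat) : R :=
  \sum_(e < N) w e * (x e)%:R.

Section PathOptimum.
Context (R : realType) (N : nat) (w : nat -> R) (q : nat -> nat).

Let wo : 'I_N.+1.-1 -> R := fun e => w e.
Let qo : 'I_N.+1 -> nat := fun i => q i.

Lemma feasible_path (x : {ffun 'I_N.+1.-1 -> nat}) :
  feasible qo x -> path_feasible N q (extend x).
Proof.
move=> xq; split=> [i iN|k Nk]; last exact: extend_out.
by have := xq (Ordinal (iN : (i < N.+1)%N)); rewrite /load sum_incident.
Qed.

Lemma total_weight_path (x : {ffun 'I_N.+1.-1 -> nat}) :
  total_weight wo x = path_weight N w (extend x).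
Proof. by apply: eq_bigr => e _; rewrite extend_ord. Qed.

Lemma path_feasible_ord (x : nat -> nat) : path_feasible N q x ->
  feasible qo [ffun e : 'I_N.+1.-1 => x e].
Proof.
move=> [xq x0] i; rewrite /load sum_incident.
have ex k : extend [ffun e : 'I_N.+1.-1 => x e] k = x k.
  have [kN|/[dup] Nk /x0->] := ltnP k N; last exact: extend_out.
  by rewrite (extend_ord _ (Ordinal kN)) ffunE.
have bx j : before (extend [ffun e : 'I_N.+1.-1 => x e]) j = before x j.
  by case: j => /=.
by rewrite bx ex xq// -ltnS.
Qed.

Lemma fstar_le (M : R) :
  (forall x, path_feasible N q x -> path_weight N w x <= M) -> fstar wo qo <= M.
Proof.
move=> xM; apply: ge_sup.
  exists (total_weight wo [ffun=> 0%N]), [ffun=> 0%N] => // i.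
  by rewrite /load big1// => e _; rewrite ffunE.
by move=> _ [x xq <-]; rewrite total_weight_path; apply/xM/feasible_path.
Qed.

Hypothesis w0 : forall e, 0 <= w e.

Lemma fstar_ge_feasible x : feasible qo x -> total_weight wo x <= fstar wo qo.
Proof.
move=> xq; apply: ub_le_sup; last by exists x.
exists (\sum_e wo e * (qo (left_end e))%:R) => _ [y yq <-].
apply: ler_sum => e _; rewrite ler_wpM2l ?w0// ler_nat.
apply: leq_trans (yq (left_end e)).
by rewrite /load (bigD1 e) ?incident_left //= leq_addr.
Qed.

Lemma fstar_ge (x : nat -> nat) : path_feasible N q x ->
  path_weight N w x <= fstar wo qo.
Proof.
move=> /path_feasible_ord /fstar_ge_feasible; apply: le_trans.
by rewrite /total_weight /path_weight; under [leRHS]eq_bigr do rewrite ffunE.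
Qed.

Lemma fhat_le_fstar : fhat wo qo <= fstar wo qo.
Proof. exact/fstar_ge_feasible/greedy_feasible. Qed.

End PathOptimum.

(** Two allocations are juxtaposed, and the joining edge [N] stays empty because [x N = 0]. *)
Lemma fstar_superadditive (R : realType) (N M : nat) (w : nat -> R) (q : nat -> nat) :
  (forall e, 0 <= w e) ->
  @fstar R N.+1 (fun e => w e) (fun i => q i) +
  @fstar R M.+1 (fun e => w (N.+1 + e)%N) (fun i => q (N.+1 + i)%N) <=
  @fstar R (N + M.+1).+1 (fun e => w e) (fun i => q i).
Proof.
move=> w0; rewrite -lerBrDr; apply: (@fstar_le _ N) => x [xq x0].
rewrite lerBrDr -lerBrDl.
apply: (@fstar_le _ M (fun e => w (N.+1 + e)%N) (fun i => q (N.+1 + i)%N)).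
move=> y [yq y0]; rewrite lerBrDl.
pose z k := if (k < N.+1)%N then x k else y (k - N.+1)%N.
apply: le_trans (fstar_ge w0 (_ : path_feasible _ q z)).
  rewrite /path_weight addnS -addSn big_split_ord big_ord_recr /= -/(path_weight _ _ _).
  rewrite /z ltnSn x0// mulr0 addr0 lerD//.
    by apply: ler_sum => e _; rewrite /= (ltn_trans (ltn_ord e)).
  by apply: ler_sum => e _; rewrite /= -addSn ltnNge leq_addr /= addKn.
split=> [i iN|k Nk]; rewrite /z; last first.
  by rewrite ltnNge (leq_trans _ Nk) ?y0//=; lia.
have [iN1|] := ltnP i N.+1.
  have := xq i iN1; case: i {iN} iN1 => [//|i] iN1.
  by rewrite /before (ltn_trans (ltnSn i) iN1).
move=> Ni; rewrite -(subnKC Ni).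
have := yq (i - N.+1)%N; have -> : (i - N.+1 <= M)%N by lia.
move=> /(_ isT); case: (i - N.+1)%N => [|j].
  by rewrite addn0 /= ltnSn subnn x0.
by rewrite addnS /= ltnNge leq_addr /= -addnS !addKn.
Qed.

(** * Paths as words, and the greedy automaton *)

(* A path is encoded by the quantity of its first user and a word whose letter
   (h, b) at index e says that edge e is heavy (h) and that user e + 1 has
   quantity 1 + b. *)
Definition letter : Type := (bool * bool)%type.

Definition heavy (s : seq letter) (e : nat) : bool := (nth (false, false) s e).1.

Definition quantity (q0 : bool) (s : seq letter) (i : nat) : nat :=
  (if i is j.+1 then (nth (false, false) s j).2 else q0).+1.

Definition weight (R : realType) (Delta : R) (h : bool) : R :=
  if h then 1 + Delta else 1.

(* In a state r, the left end of the current edge has r.1 units left once the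
   heavy edges have been served, if this edge is heavy, and r.2 units left for
   this edge, if it is light.  A light edge must also leave to the following
   heavy edge what the latter has taken; this lookahead letter is b. *)
Definition amount (r : nat * nat) (a b : letter) : nat :=
  if a.1 then minn r.1 a.2.+1
  else minn r.2 (a.2.+1 - (if b.1 then minn a.2.+1 b.2.+1 else 0)).

(** Heavy edges are served first, so a light amount is deducted from the second component only. *)
Definition next_state (a : letter) (x : nat) : nat * nat :=
  ((a.2.+1 - (if a.1 then x else 0))%N, (a.2.+1 - x)%N).

(** The default lookahead after the last letter is light, so that nothing is held back for an edge
    beyond the end. *)
Fixpoint value (R : realType) (p : bool -> R) (r : nat * nat) (s : seq letter) : R :=
  if s is a :: t then
    let x := amount r a (head (false, false) t) in
    p a.1 * x%:R + value p (next_state a x) t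
  else 0.

Lemma valueE (R : realType) (p : bool -> R) (s : seq letter) (r : nat -> nat * nat)
    (x : nat -> nat) :
  (forall e, (e < size s)%N ->
    x e = amount (r e) (nth (false, false) s e) (nth (false, false) s e.+1) /\
    r e.+1 = next_state (nth (false, false) s e) (x e)) ->
  path_weight (size s) (p \o heavy s) x = value p (r 0%N) s.
Proof.
elim: s r x => [|a s IH] r x H; first by rewrite /path_weight big_ord0.
rewrite /path_weight big_ord_recl /=.
have [x0 r1] := H 0%N (ltn0Sn _).
rewrite {1}/heavy /= in x0 r1 *; rewrite nth0 in x0; rewrite -x0; congr (_ + _).
by rewrite -r1 -(IH (r \o succn) (x \o succn)) // => e es; exact: H.
Qed.

Section GreedyWord.
Context (R : realType) (Delta : R) (q0 : bool) (s : seq letter).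
Hypothesis Delta_gt0 : 0 < Delta.

Let N := size s.
Let w (e : nat) : R := weight Delta (heavy s e).
Let q := quantity q0 s.

Let wo : 'I_N.+1.-1 -> R := fun e => w e.
Let qo : 'I_N.+1 -> nat := fun i => q i.

Definition fhat_word : R := fhat wo qo.
Definition fstar_word : R := fstar wo qo.

Let x : nat -> nat := extend (greedy wo qo).

Let x_feasible : path_feasible N q x.
Proof. exact/feasible_path/greedy_feasible. Qed.

Lemma prec_heavy (e f : 'I_N.+1.-1) :
  prec wo e f = (~~ heavy s f && heavy s e) || (heavy s e == heavy s f) && (e < f)%N.
Proof.
rewrite /prec /wo /w /weight.
case: (heavy s e); case: (heavy s f); rewrite ?eqxx ?ltxx //=.
- by rewrite ltrDl Delta_gt0.
- by rewrite ltNge lerDl (ltW Delta_gt0) lt_eqF// ltrDl.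
Qed.

Lemma higher_load_path (e : 'I_N.+1.-1) (i : 'I_N.+1) :
  higher_load wo (greedy wo qo) e i =
  (before (extend (fun f => if prec wo f e then greedy wo qo f else 0)) i +
   extend (fun f => if prec wo f e then greedy wo qo f else 0) i)%N.
Proof. by rewrite -sum_incident /higher_load big_mkcondr. Qed.

Let hl (e f : nat) : nat :=
  if (~~ heavy s e && heavy s f) || (heavy s e == heavy s f) && (f < e)%N
  then x f else 0%N.

Lemma extend_prec (e : 'I_N.+1.-1) k :
  extend (fun f => if prec wo f e then greedy wo qo f else 0%N) k = hl e k.
Proof.
have [kN|Nk] := ltnP k N; last by rewrite /hl /x !extend_out// if_same.
rewrite (extend_ord _ (Ordinal kN)) prec_heavy /= [heavy s k == _]eq_sym /hl.
by rewrite /x (extend_ord _ (Ordinal kN)).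
Qed.

Let x_exhausts e : (e < N)%N ->
  (q e <= x e + (before (hl e) e + hl e e))%N \/
  (q e.+1 <= x e + (hl e e + hl e e.+1))%N.
Proof.
move=> eN; have [i ie qi] := greedy_exhausts wo qo (Ordinal eN).
have bl k : before (extend (fun f => if prec wo f (Ordinal eN) then greedy wo qo f
    else 0%N)) k = before (hl e) k.
  by case: k => //= k; rewrite extend_prec.
move: qi; rewrite higher_load_path bl extend_prec /= /x (extend_ord _ (Ordinal eN)).
by case: (incidentP ie) => ->; [left|right].
Qed.

Let state e : nat * nat :=
  ((q e - before (fun f => if heavy s f then x f else 0) e)%N, (q e - before x e)%N).

Let hl_self e : hl e e = 0%N.
Proof. by rewrite /hl andNb ltnn andbF. Qed.

Let hl_succ e : hl e e.+1 = if ~~ heavy s e && heavy s e.+1 then x e.+1 else 0%N.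
Proof. by rewrite /hl ltnNge leqnSn andbF orbF. Qed.

(** Of its neighbors, only a heavy one on the left has priority over a heavy edge. Feasibility then
    gives the upper bound and the exhaustion of one end the lower bound. *)
Let x_heavy e : (e < N)%N -> heavy s e -> x e = minn (state e).1 (q e.+1).
Proof.
move=> eN he; have [xq _] := x_feasible.
have := xq e (ltnW eN); have := xq e.+1 eN; have := x_exhausts eN.
rewrite hl_self hl_succ he /=.
have -> : before (hl e) e = before (fun f => if heavy s f then x f else 0%N) e.
  case: e he {eN} => //= e he; rewrite /hl he ltnSn andbT.
  by case: (heavy s e).
have : (before (fun f => if heavy s f then x f else 0%N) e <= before x e)%N.
  by case: e {he eN} => //= e; case: ifP.
lia.
Qed.

(** The left neighbor always has priority over a light edge, the right one only if it is heavy. In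
    that case the right one carries the minimum of its two quantities, as the light edge before it
    takes nothing in the heavy stage. *)
Let x_amount e : (e < N)%N ->
  x e = amount (state e) (nth (false, false) s e) (nth (false, false) s e.+1).
Proof.
move=> eN; rewrite /amount -/(heavy s e) -/(heavy s e.+1) -/(quantity q0 s e.+1) -/q.
case: ifPn => [/(x_heavy eN)//|he].
have [xq _] := x_feasible.
have := xq e (ltnW eN); have := xq e.+1 eN; have := x_exhausts eN.
have -> : before (hl e) e = before x e.
  case: e he {eN} => //= e he; rewrite /hl (negbTE he) ltnSn andbT /=.
  by case: (heavy s e).
rewrite hl_self hl_succ he /=.
case: ifPn => [he1|_]; last by lia.
(* The default letter is light, so a heavy letter belongs to an actual edge. *)
have eN1 : (e.+1 < N)%N.
  by rewrite ltnNge; apply: contraL he1 => Ne; rewrite /heavy nth_default.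
have := x_heavy eN1 he1; rewrite /state /= (negbTE he) subn0.
rewrite -/(quantity q0 s e.+2) -/q; lia.
Qed.

Let x_state e : (e < N)%N ->
  state e.+1 = next_state (nth (false, false) s e) (x e).
Proof. by []. Qed.

Lemma greedy_value (p : bool -> R) :
  path_weight N (p \o heavy s) x = value p (q0.+1, q0.+1) s.
Proof.
rewrite (@valueE _ _ _ state)// => e eN.
by split; [exact: x_amount|exact: x_state].
Qed.

Lemma fhat_wordE : fhat_word = value (weight Delta) (q0.+1, q0.+1) s.
Proof. by rewrite -greedy_value /fhat_word /fhat total_weight_path. Qed.

(* The greedy allocation serves every maximal run of heavy edges from left to
   right, and is therefore optimal for the total heavy amount. *)
Lemma heavy_optimal (y : nat -> nat) : path_feasible N q y ->
  (\sum_(e < N) heavy s e * y e <= \sum_(e < N) heavy s e * x e)%N.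
Proof.
move=> [yq _].
(* The second inequality is the first one for [k - 1], written without subtraction. If the right end
   limits [x k], the comparison up to [k] extends; if the left end does, [x] uses all of [q k] on
   heavy edges, and the comparison up to [k - 1] extends by two edges. *)
suff: forall k, (k <= N)%N ->
  (\sum_(e < k) heavy s e * y e <= \sum_(e < k) heavy s e * x e /\
   \sum_(e < k) heavy s e * y e + before (fun f => heavy s f * x f) k
   <= \sum_(e < k) heavy s e * x e + before (fun f => heavy s f * y f) k)%N.
  by move=> /(_ N (leqnn _))[].
elim=> [|k IH] kN; first by rewrite !big_ord0.
have [IH1 IH2] := IH (ltnW kN); rewrite !big_ord_recr /=.
have := yq k (ltnW kN); have := yq k.+1 kN; rewrite /=.
have [hk|hk] := boolP (heavy s k); last by rewrite !mul0n !addn0.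
rewrite (x_heavy kN hk) !mul1n /=; move: IH1 IH2.
case: k {IH kN hk} => [|k] /=; first by rewrite !big_ord0; lia.
case: (heavy s k); rewrite ?mul0n ?mul1n; lia.
Qed.

(** The weight is the total amount plus [Delta] times the heavy amount. The former is at most half
    the total quantity because each unit is counted at both ends of its edge; the latter is bounded
    by [heavy_optimal]. *)
Lemma fstar_word_le : fstar_word <=
  (\sum_(i < N.+1) q i)%:R / 2 + Delta * value (fun b => b%:R) (q0.+1, q0.+1) s.
Proof.
apply: fstar_le => y yq; rewrite -greedy_value.
have -> : path_weight N w y = (\sum_(e < N) y e)%:R +
    Delta * (\sum_(e < N) heavy s e * y e)%:R.
  rewrite !natr_sum mulr_sumr -big_split /=; apply: eq_bigr => e _.
  by rewrite /w /weight; case: (heavy s e); rewrite ?mul0n ?mul1n; ring.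
apply: lerD; last first.
  rewrite ler_wpM2l ?(ltW Delta_gt0)//.
  have -> : path_weight N ((fun b => b%:R) \o heavy s) x =
      (\sum_(e < N) heavy s e * x e)%:R :> R.
    by rewrite natr_sum; apply: eq_bigr => e _; rewrite natrM.
  by rewrite ler_nat heavy_optimal.
rewrite ler_pdivlMr// -natrM ler_nat.
have [yq' y0] := yq.
apply: (@leq_trans (\sum_(i < N.+1) (before y i + y i)))%N; last first.
  by apply: leq_sum => i _; rewrite yq' // -ltnS.
rewrite big_split /= big_ord_recl [X in (_ <= _ + X)%N]big_ord_recr /= (y0 N)//.
by rewrite addn0 add0n muln2 -addnn.
Qed.

Lemma fhat_word_le_fstar_word : fhat_word <= fstar_word.
Proof.
apply: fhat_le_fstar => e; rewrite /w /weight; case: ifP => _ //.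
by rewrite addr_ge0// ltW.
Qed.

End GreedyWord.

(** * Averages over uniform words *)

Section Averages.
Context (R : realType).
Implicit Types (f g : seq letter -> R).

Definition mean_letter (h : letter -> R) : R :=
  (h (false, false) + h (false, true) + h (true, false) + h (true, true)) / 4.

Fixpoint mean_word (N : nat) f : R :=
  if N is M.+1 then mean_letter (fun a => mean_word M (fun s => f (a :: s)))
  else f [::].

Definition mean_bool (h : bool -> R) : R := (h false + h true) / 2.

Definition mean_instance (N : nat) (F : bool -> seq letter -> R) : R :=
  mean_bool (fun q0 => mean_word N (F q0)).

Lemma ler_mean_word N f g :
  (forall s, size s = N -> f s <= g s) -> mean_word N f <= mean_word N g.
Proof.
elim: N f g => [|N IH] f g fg /=; first exact: fg.
have H a : mean_word N (fun s => f (a :: s)) <= mean_word N (fun s => g (a :: s)).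
  by apply: IH => s sN; apply: fg; rewrite /= sN.
by rewrite ler_wpM2r ?invr_ge0// !lerD.
Qed.

Lemma eq_mean_word N f g :
  (forall s, size s = N -> f s = g s) -> mean_word N f = mean_word N g.
Proof.
by move=> fg; apply/le_anti/andP; split; apply: ler_mean_word => s /fg ->.
Qed.

Lemma mean_wordD N f g :
  mean_word N (fun s => f s + g s) = mean_word N f + mean_word N g.
Proof.
elim: N f g => [//|N IH] f g /=; rewrite /mean_letter !IH; lra.
Qed.

Lemma mean_wordZ N c f : mean_word N (fun s => c * f s) = c * mean_word N f.
Proof. by elim: N f => [//|N IH] f /=; rewrite /mean_letter !IH; lra. Qed.

Lemma mean_word_cst N c : mean_word N (fun=> c) = c.
Proof. by elim: N => [//|N IH] /=; rewrite /mean_letter !IH; lra. Qed.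

Lemma mean_word_cat M N f :
  mean_word (M + N) f = mean_word M (fun s => mean_word N (fun t => f (s ++ t))).
Proof. by elim: M f => [//|M IH] f /=; rewrite /mean_letter !IH. Qed.

Lemma ler_mean_instance N F G :
  (forall q0 s, size s = N -> F q0 s <= G q0 s) ->
  mean_instance N F <= mean_instance N G.
Proof.
move=> FG; rewrite ler_wpM2r ?invr_ge0// lerD//; apply: ler_mean_word => s; exact: FG.
Qed.

Lemma mean_quantity N :
  mean_instance N (fun q0 s => (\sum_(i < N.+1) quantity q0 s i)%:R) =
  3 / 2 * N.+1%:R.
Proof.
have H M : mean_word M (fun s => (\sum_(i < M) (nth (false, false) s i).2.+1)%:R)
    = 3 / 2 * M%:R.
  elim: M => [|M IH] /=; first by rewrite big_ord0 mulr0.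
  have E a : mean_word M (fun s =>
      (\sum_(i < M.+1) (nth (false, false) (a :: s) i).2.+1)%:R) =
      a.2.+1%:R + 3 / 2 * M%:R.
    rewrite -IH -[X in X + _](mean_word_cst M) -mean_wordD.
    by apply: eq_mean_word => s _; rewrite big_ord_recl natrD.
  by rewrite /mean_letter !E /= -[M.+1]addn1 natrD; lra.
have E (q0 : bool) : mean_word N (fun s => (\sum_(i < N.+1) quantity q0 s i)%:R) =
    q0.+1%:R + 3 / 2 * N%:R.
  rewrite -H -[X in X + _](mean_word_cst N) -mean_wordD.
  by apply: eq_mean_word => s _; rewrite big_ord_recl natrD.
by rewrite /mean_instance /mean_bool !E /= -[N.+1]addn1 natrD; lra.
Qed.

End Averages.

(** * Poisson equations and growth rates *)

Definition states : seq (nat * nat) :=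
  [:: (0, 0); (1, 0); (1, 1); (2, 0); (2, 1); (2, 2)]%N.

(* The potentials solve the Poisson equations [total_poisson] and
   [heavy_poisson]; they are scaled by 361 and 38 to become integral. *)
Definition total_potential (r : nat * nat) (a : letter) : int :=
  match if a.1 then r.1 else r.2 with
  | 0%N => if a.2 then - 31%:Z else - 95%:Z
  | 1%N => if a.2 then (if a.1 then 266%:Z else 216%:Z) else if a.1 then 66%:Z else 0
  | _ => if a.2 then (if a.1 then 427%:Z else 311%:Z) else if a.1 then 66%:Z else 0
  end.

Definition heavy_potential (r : nat * nat) (a : letter) : int :=
  match if a.1 then r.1 else 0%N with
  | 0%N => if a.2 then 6%:Z else 0
  | 1%N => if a.2 then 38%:Z else 24%:Z
  | _ => if a.2 then 62%:Z else 24%:Z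
  end.

Definition sum_letter (h : letter -> int) : int :=
  h (false, false) + h (false, true) + h (true, false) + h (true, true).

(** A finite check: [states] lists the pairs with [r.2 <= r.1 <= 2], and whatever is deducted from
    the first component is also deducted from the second. *)
Lemma next_states (r : nat * nat) (a b : letter) : 
  r \in states -> next_state a (amount r a b) \in states.
Proof.
move=> rs; have : all (fun r : nat * nat => next_state a (amount r a b) \in states) states.
  by case: a => [[] []]; case: b => [[] []].
by move=> /allP/(_ r rs).
Qed.

(** The Markov chain lives on pairs of a state and a current letter; the uniform lookahead [b]
    becomes the next current letter. The constant makes 232/361 the long-run mean amount per
    edge. *)
Lemma total_poisson (r : nat * nat) (a : letter) : r \in states ->
  sum_letter (fun b => 361%:Z * (amount r a b)%:Z +
                       total_potential (next_state a (amount r a b)) b)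
  = 4%:Z * (total_potential r a + 232%:Z).
Proof.
move=> rs; have : all (fun r : nat * nat =>
    sum_letter (fun b => 361%:Z * (amount r a b)%:Z +
    total_potential (next_state a (amount r a b)) b)
    == 4%:Z * (total_potential r a + 232%:Z)) states.
  by case: a => [[] []]; vm_compute.
by move=> /allP/(_ r rs)/eqP.
Qed.

(** The same chain, rewarded on heavy edges only, has long-run mean 17/38 per edge. *)
Lemma heavy_poisson (r : nat * nat) (a : letter) : r \in states ->
  sum_letter (fun b => 38%:Z * (a.1 * amount r a b)%N%:Z +
                       heavy_potential (next_state a (amount r a b)) b)
  = 4%:Z * (heavy_potential r a + 17%:Z).
Proof.
move=> rs; have : all (fun r : nat * nat =>
    sum_letter (fun b => 38%:Z * (a.1 * amount r a b)%N%:Z +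
    heavy_potential (next_state a (amount r a b)) b)
    == 4%:Z * (heavy_potential r a + 17%:Z)) states.
  by case: a => [[] []]; vm_compute.
by move=> /allP/(_ r rs)/eqP.
Qed.

Section Rate.
Context (R : realType) (al be : R).

(** A unit earns [al], and [be] more on a heavy edge: [(1, Delta)] yields the greedy weight and
    [(0, 1)] the heavy amount. *)
Definition rate : R := al * (232 / 361) + be * (17 / 38).

Let p (h : bool) : R := al + be * h%:R.

Let pot (r : nat * nat) (a : letter) : R :=
  al * ((total_potential r a)%:~R / 361) + be * ((heavy_potential r a)%:~R / 38).

Let pot_poisson (r : nat * nat) (a : letter) : r \in states ->
  mean_letter (fun b => p a.1 * (amount r a b)%:R +
                        pot (next_state a (amount r a b)) b) = pot r a + rate.
Proof.
move=> rs.
have /(congr1 (fun z : int => z%:~R : R)) := total_poisson a rs.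
have /(congr1 (fun z : int => z%:~R : R)) := heavy_poisson a rs.
have natZ (n : nat) : n%:Z%:~R = n%:R :> R by [].
rewrite /sum_letter !(rmorphD, rmorphM) /= !natZ.
(* Here 152 = 4 * 38 and 1444 = 4 * 361: four letters times the scale of the potential. *)
move=> /(congr1 ( *%R (be / 152))) E2 /(congr1 ( *%R (al / 1444))) E1.
move: E1 E2; rewrite /mean_letter /p /pot /rate /=; lra.
Qed.

Let states_bounded (g : nat * nat -> letter -> R) :
  exists C, forall r a, r \in states -> `|g r a| <= C.
Proof.
exists (\sum_(r <- states) \sum_(a : letter) `|g r a|) => r a rs.
rewrite (big_rem r rs) /= (bigD1 a)//= -addrA lerDl addr_ge0//.
  exact: sumr_ge0.
by apply: sumr_ge0 => *; exact: sumr_ge0.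
Qed.

(** After subtraction of the linear term and the potential, the Poisson equation turns the deviation
    for a given first letter into the mean of the deviations one letter later. A bound for words of
    one letter therefore holds for all lengths. *)
Lemma mean_value_rate : exists C, forall N,
  `|mean_instance N (fun q0 => value p (q0.+1, q0.+1)) - N%:R * rate| <= C.
Proof.
have [C HC] := states_bounded (fun r a =>
  p a.1 * (amount r a (false, false))%:R - rate - pot r a).
have H N r a : r \in states ->
    `|mean_word N (fun s => value p r (a :: s)) - N.+1%:R * rate - pot r a| <= C.
  elim: N r a => [|N IH] r a rs; first by rewrite /= addr0 mul1r HC.
  have -> : mean_word N.+1 (fun s => value p r (a :: s)) =
      mean_letter (fun b => p a.1 * (amount r a b)%:R +
        mean_word N (fun s => value p (next_state a (amount r a b)) (b :: s))).
    rewrite [LHS]/=; congr mean_letter; apply/funext => b.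
    by rewrite -[X in X + _](mean_word_cst N) -mean_wordD.
  pose D b := mean_word N (fun s => value p (next_state a (amount r a b)) (b :: s))
    - N.+1%:R * rate - pot (next_state a (amount r a b)) b.
  rewrite (_ : _ - _ = mean_letter D); last first.
    have := pot_poisson a rs; rewrite /mean_letter /D => E.
    rewrite -[N.+2]addn1 natrD; move: E; lra.
  have DC b : `|D b| <= C by apply/IH/next_states.
  rewrite /mean_letter ler_norml.
  have := DC (false, false); have := DC (false, true).
  have := DC (true, false); have := DC (true, true).
  rewrite !ler_norml; lra.
have [C' HC'] := states_bounded pot.
exists (C + C') => -[|N].
  rewrite /mean_instance /mean_bool /= mul0r subr0 addr0 mul0r normr0.
  by rewrite addr_ge0 ?(le_trans (normr_ge0 _) (HC (0, 0)%N (false, false) _)) ?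
    (le_trans (normr_ge0 _) (HC' (0, 0)%N (false, false) _)).
have K (q0 : bool) a :
    `|mean_word N (fun s => value p (q0.+1, q0.+1) (a :: s)) - N.+1%:R * rate| <= C + C'.
  have qs : (q0.+1, q0.+1) \in states by case: q0.
  rewrite -[X in `|X|](subrK (pot (q0.+1, q0.+1) a)).
  by apply: le_trans (ler_normD _ _) _; rewrite lerD ?H ?HC'.
have K' (q0 : bool) :
    `|mean_word N.+1 (value p (q0.+1, q0.+1)) - N.+1%:R * rate| <= C + C'.
  pose W a := mean_word N (fun s => value p (q0.+1, q0.+1) (a :: s)).
  have KW a : `|W a - N.+1%:R * rate| <= C + C' by exact: K.
  have := KW (false, false); have := KW (false, true).
  have := KW (true, false); have := KW (true, true).
  rewrite [mean_word N.+1 _]/(mean_letter W) /mean_letter.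
  rewrite !ler_norml; lra.
have := K' true; have := K' false.
rewrite /mean_instance /mean_bool !ler_norml; lra.
Qed.

End Rate.

(** * Fekete's lemma *)

Lemma superadditive_natmul (R : realType) (u : nat -> R) :
  (forall m n, u m + u n <= u (m + n)%N) -> (forall n, 0 <= u n) ->
  forall k m, k%:R * u m <= u (k * m)%N.
Proof.
move=> uD u0; elim=> [|k IH] m; first by rewrite mul0r.
by rewrite mulSn -[k.+1]add1n natrD mulrDl mul1r (le_trans _ (uD _ _))// lerD2l.
Qed.

(** The limit is the supremum of the ratios. If [u m / m] is close to it, Euclidean division of [n]
    by [m] gives [u n >= (n / m - 1) * u m], whence [u n / n >= u m / m - u m / n]. *)
Lemma fekete (R : realType) (u : nat -> R) (K : R) :
  (forall m n, u m + u n <= u (m + n)%N) -> (forall n, 0 <= u n) ->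
  (forall n, u n <= K * n%:R) -> cvgn (fun n => u n / n%:R).
Proof.
move=> uD u0 uK.
pose S := [set u n.+1 / n.+1%:R | n in setT].
have Subd : has_ubound S.
  by exists K => _ [n _ <-]; rewrite ler_pdivrMr// ltr0n.
have S0 : S !=set0 by exists (u 1%N / 1%:R), 0%N.
apply/cvg_ex; exists (sup S); apply/cvgrPdist_le => e e0.
have [_ [m _ <-] um] := sup_adherent (divr_gt0 e0 (ltr0n R 2)) (conj S0 Subd).
near=> n.
have n0 : (0 < n)%N by near: n; exact: nbhs_infty_gt.
have nR : 0 < n%:R :> R by rewrite ltr0n.
have mR : 0 < m.+1%:R :> R by rewrite ltr0n.
have en : u m.+1 / n%:R <= e / 2.
  rewrite ler_pdivrMr// mulrC -ler_pdivrMr ?divr_gt0//.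
  by near: n; exact: nbhs_infty_ger.
have unS : u n / n%:R <= sup S.
  by apply: ub_le_sup => //; exists n.-1; rewrite ?prednK.
rewrite ger0_norm ?subr_ge0// lerBlDr.
have uk : (n %/ m.+1)%:R * u m.+1 <= u n.
  apply: le_trans (superadditive_natmul uD u0 _ _) _.
  rewrite [in leRHS](divn_eq n m.+1).
  by apply: le_trans (uD _ _); rewrite lerDl.
have nk : n%:R / m.+1%:R - 1 <= (n %/ m.+1)%:R :> R.
  rewrite lerBlDr ler_pdivrMr// natr1 -natrM ler_nat ltnW//.
  by rewrite -ltn_divLR.
have : u m.+1 / m.+1%:R - u m.+1 / n%:R <= u n / n%:R.
  rewrite ler_pdivlMr// mulrBl divfK ?gt_eqF//.
  apply: le_trans (le_trans (ler_wpM2r (u0 m.+1) nk) uk).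
  by rewrite le_eqVlt; apply/orP; left; apply/eqP; ring.
move: um en {unS}.
move: (sup S) (u m.+1 / _) (u m.+1 / _) (u n / _) => s A B D; lra.
Unshelve. all: by end_near.
Qed.

(** * Expectation of a function of finitely many fair bits *)

Section NullSets.
Import HBNNSimple.

(** The integral is a supremum over nonnegative simple functions below [f]. Setting such a function
    to 0 on [N] keeps its integral and brings it below [g]. *)
Lemma ge0_le_integral_off_null d (T : measurableType d) (R : realType)
    (mu : {measure set T -> \bar R}) (N : set T) (f g : T -> \bar R) :
  measurable N -> mu N = 0%E ->
  (forall t, 0 <= f t)%E -> (forall t, 0 <= g t)%E ->
  (forall t, ~ N t -> f t = g t) ->
  (\int[mu]_t f t <= \int[mu]_t g t)%E.
Proof.
move=> mN N0 f0 g0 fg; rewrite !ge0_integralTE//.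
apply: ge_ereal_sup => _ [h /= hf <-].
have [h' h'E] : exists h' : {nnsfun T >-> R},
    forall t, h' t = if t \in ~` N then h t else 0.
  exists (proj_nnsfun h (measurableC mN)) => t.
  by rewrite -mrestrict patchE.
apply: ereal_sup_ubound; exists h'.
  move=> t; rewrite /= h'E; case: ifPn => [|_]; last exact: g0.
  by rewrite inE => /fg <-.
rewrite -!integralT_nnsfun; apply: ge0_ae_eq_integral => //.
- exact/measurable_EFinP.
- exact/measurable_EFinP.
- by move=> t _; rewrite lee_fin.
- by move=> t _; rewrite lee_fin.
exists N; split=> // t /= ht; apply: contrapT => Nt; apply: ht => _.
by rewrite h'E mem_set.
Qed.

(* [ae_eq_integral] is of no use for fhat and fstar, which are not known to be
   measurable functions of the sample. *)
Lemma integral_off_null d (T : measurableType d) (R : realType)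
    (mu : {measure set T -> \bar R}) (N : set T) (f g : T -> \bar R) :
  measurable N -> mu N = 0%E -> (forall t, ~ N t -> f t = g t) ->
  (\int[mu]_t f t = \int[mu]_t g t)%E.
Proof.
move=> mN N0 fg; rewrite integralE [RHS]integralE.
congr (_ - _)%E; apply/le_anti/andP; split;
  apply: (ge0_le_integral_off_null mN) => // t Nt;
  by rewrite ?funeposE ?funenegE fg.
Qed.

End NullSets.

Section FiniteExpectation.
Context d (T : measurableType d) (R : realType) (P : probability T R).
Context (I : finType) (E : I -> bool -> set T).
Hypothesis mE : forall k b, measurable (E k b).
Hypothesis E_disjoint : forall k t, E k true t -> ~ E k false t.

Let C (c : {ffun I -> bool}) : set T := \bigcap_(k in [set` [set: I]%SET]) E k (c k).

Hypothesis PC : forall c, P (C c) = ((2 ^+ #|I|)^-1)%:E.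

Let mC c : measurable (C c).
Proof. by apply: fin_bigcap_measurable => // k _. Qed.

Let C_inj c c' t : C c t -> C c' t -> c = c'.
Proof.
move=> ct ct'; apply/ffunP => k.
have kI : [set` [set: I]%SET] k by rewrite /= inE.
have := ct k kI; have := ct' k kI.
by case: (c k) (c' k) => [] [] // A B;
  [case: (E_disjoint B A)|case: (E_disjoint A B)].
Qed.

Let simple (F : {ffun I -> bool} -> R) (t : T) : R := \sum_c F c * \1_(C c) t.

Let simpleE F c t : C c t -> simple F t = F c.
Proof.
move=> ct; rewrite /simple (bigD1 c)//= indicE mem_set// mulr1 big1 ?addr0//.
move=> c' /eqP cc'; rewrite indicE memNset ?mulr0// => /(C_inj ct) cE.
by rewrite cE in cc'.
Qed.

Let integral_simple F :
  (\int[P]_t (simple F t)%:E = ((2 ^+ #|I|)^-1 * \sum_c F c)%:E)%E.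
Proof.
under eq_integral do rewrite /simple -sumEFin.
rewrite integral_sum//; last first.
  move=> c; under eq_fun do rewrite EFinM.
  exact/integrableZl/integrable_indic.
rewrite mulr_sumr -sumEFin; apply: eq_bigr => c _.
under eq_integral do rewrite EFinM.
rewrite integralZl//; last exact: integrable_indic.
by rewrite integral_indic// setIT [X in (_ * X)%E](PC c) -EFinM mulrC.
Qed.

(** The cells [C c] are disjoint and their probabilities add up to 1, so [f] agrees with a simple
    function outside a null set. *)
Lemma expectation_finite (f : T -> R) (F : {ffun I -> bool} -> R) :
  (forall (c : {ffun I -> bool}) t, (forall k, E k (c k) t) -> f t = F c) ->
  ('E_P[f] = ((2 ^+ #|I|)^-1 * \sum_c F c)%:E)%E.
Proof.
move=> fF; pose G : set T := \bigcup_c C c.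
have mG : measurable G by apply: fin_bigcup_measurable => // c _.
have PG : P G = 1%E.
  rewrite -[G]setIT -integral_indic//.
  rewrite (_ : (fun t => (\1_G t)%:E) = fun t => (simple (fun=> 1) t)%:E).
    rewrite integral_simple sumr_const card_ffun card_bool.
    by rewrite -[X in _ * X]/((2 ^ #|I|)%:R) natrX mulVf// expf_neq0.
  apply/funext => t; congr EFin.
  have [[c _ ct]|Gt] := pselect (G t).
    by rewrite (simpleE _ ct) indicE mem_set//; exists c.
  rewrite indicE memNset// /simple big1// => c _.
  by rewrite indicE memNset ?mulr0// => ct; apply: Gt; exists c.
have PGC : P (~` G) = 0%E by rewrite probability_setC// PG subee.
rewrite unlock -(integral_simple F); apply: (@integral_off_null _ _ _ _ (~` G)).
- exact: measurableC.
- exact: PGC.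
move=> t /contrapT[c _ ct]; congr EFin; rewrite (simpleE _ ct); apply: fF => k.
by apply: ct; rewrite /= inE.
Qed.

End FiniteExpectation.

(** * From random instances to uniform words *)

Lemma mean_word_tuple (R : realType) N (f : seq letter -> R) :
  mean_word N f = (4 ^+ N)^-1 * \sum_(s : N.-tuple letter) f s.
Proof.
elim: N f => [|N IH] f.
  rewrite expr0 invr1 mul1r (big_pred1 [tuple]) // => t.
  by apply/esym/eqP; exact: tuple0.
pose cons (p : letter * N.-tuple letter) := cons_tuple p.1 p.2.
have cons_bij : bijective cons.
  exists (fun t : N.+1.-tuple letter => (thead t, behead_tuple t)).
  - by move=> [a t]; rewrite /cons /= theadE; congr pair; exact/val_inj.
  - by move=> t; rewrite [RHS]tuple_eta; exact: val_inj.
rewrite (reindex cons) /=; last exact: onW_bij.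
rewrite -(pair_bigA _ (fun a (t : N.-tuple letter) => f (a :: t))) /=.
have -> (g : letter -> R) : \sum_a g a = \sum_x \sum_y g (x, y).
  by rewrite pair_bigA; apply: eq_bigr => -[].
rewrite !big_bool /mean_letter !IH exprS invfM.
by rewrite /=; move: (4 ^+ N)^-1 => c; lra.
Qed.

Lemma mean_instance_sum (R : realType) N
    (h : ('I_N -> bool) -> ('I_N.+1 -> bool) -> R) :
  mean_instance N (fun q0 s =>
    h (fun e => heavy s e)
      (fun i => if val i is j.+1 then (nth (false, false) s j).2 else q0)) =
  (2 ^+ #|{: 'I_N + 'I_N.+1}|)^-1 *
  \sum_(c : {ffun 'I_N + 'I_N.+1 -> bool}) h (c \o inl) (c \o inr).
Proof.
rewrite /mean_instance /mean_bool !mean_word_tuple -mulrDr.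
(* Letter [j] holds the bits of edge [j] and of user [j.+1]. The code is bijective, being injective
   between sets of equal size 2 * 4 ^ N = 2 ^ (2 * N + 1). *)
pose code (p : bool * N.-tuple letter) : {ffun 'I_N + 'I_N.+1 -> bool} :=
  [ffun k => match k with
   | inl e => (tnth p.2 e).1
   | inr i => if val i is j.+1 then (nth (false, false) p.2 j).2 else p.1
   end].
have code_inj : injective code.
  move=> [a s] [b t] /ffunP E; congr pair.
    by have := E (inr ord0); rewrite !ffunE.
  apply: eq_from_tnth => e; apply/eqP; rewrite -pair_eqE; apply/andP; split; apply/eqP.
    by have := E (inl e); rewrite !ffunE.
  by have := E (inr (lift ord0 e)); rewrite !ffunE /= -!tnth_nth.
have cardE : #|{ffun 'I_N + 'I_N.+1 -> bool}| = #|{: bool * N.-tuple letter}|.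
  rewrite card_ffun card_sum !card_ord card_prod card_tuple card_prod card_bool.
  by rewrite addnS expnS expnD expnMn.
rewrite (reindex code) /=; last by apply/onW_bij/inj_card_bij; rewrite // cardE.
rewrite -(pair_bigA _ (fun (a : bool) (s : N.-tuple letter) =>
  h (code (a, s) \o inl) (code (a, s) \o inr))) /= big_bool /=.
have E (a : bool) (s : N.-tuple letter) : h (code (a, s) \o inl) (code (a, s) \o inr) =
    h (fun e => heavy s e)
      (fun i => if val i is j.+1 then (nth (false, false) s j).2 else a).
  congr h; apply/funext => k; rewrite /= ffunE //.
  by rewrite /heavy (tnth_nth (false, false)).
rewrite (eq_bigr _ (fun s _ => E true s)) (eq_bigr _ (fun s _ => E false s)).
rewrite [in RHS]addrC mulrAC -invfM; congr (_^-1 * _).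
rewrite card_sum !card_ord addnS exprS mulrC; congr (_ * _).
by rewrite addnn -mul2n exprM (_ : 2 ^+ 2 = 4 :> R)// -natrX.
Qed.

Section InstanceExpectation.
Context d (T : measurableType d) (R : realType) (P : probability T R).
Context (N : nat) (Delta : R) (W : 'I_N -> {RV P >-> R}) (Q : 'I_N.+1 -> {RV P >-> nat}).
Hypothesis Delta_gt0 : 0 < Delta.
Hypothesis WQ : @random_instance _ T R P N.+1 Delta W Q.

Let E (k : 'I_N + 'I_N.+1) (b : bool) : set T :=
  match k with
  | inl e => W e @^-1` [set weight Delta b]
  | inr i => Q i @^-1` [set b.+1]
  end.

Let E_events k b :
  match k with inl e => events (W e) | inr i => events (Q i) end (E k b).
Proof.
case: k => [e|i] /=.
  by exists [set weight Delta b]; rewrite ?setTI.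
by exists [set b.+1]; rewrite ?setTI.
Qed.

Let mE k b : measurable (E k b).
Proof.
by case: k => [e|i]; rewrite /E -[X in measurable X]setTI; exact: measurable_funP.
Qed.

Let E_disjoint k t : E k true t -> ~ E k false t.
Proof.
case: k => [e|i] /= -> //; rewrite /weight => /eqP.
by rewrite -subr_eq0 addrAC subrr add0r gt_eqF.
Qed.

Let PE k b : P (E k b) = (2^-1)%:E.
Proof.
case: WQ => WU QU _; case: k => [e|i].
  by have [_] := WU e; apply; rewrite !inE /weight; case: b; rewrite eqxx ?orbT.
by have [_] := QU i; apply; rewrite !inE; case: b.
Qed.

(** By independence all combinations of the two values of each weight and each quantity are equally
    likely. *)
Lemma expectation_instance (h : ('I_N -> R) -> ('I_N.+1 -> nat) -> R) :
  ('E_P[fun t => h (W^~ t) (Q^~ t)] =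
  (mean_instance N (fun q0 s =>
     h (fun e => weight Delta (heavy s e)) (fun i => quantity q0 s i)))%:E)%E.
Proof.
rewrite (@expectation_finite _ _ _ P _ E mE E_disjoint _ _ (fun c =>
  h (fun e => weight Delta (c (inl e))) (fun i => (c (inr i)).+1))).
- congr EFin; rewrite -(mean_instance_sum (fun u v =>
    h (fun e => weight Delta (u e)) (fun i => (v i).+1))).
  congr mean_instance; apply/funext => q0; apply/funext => s.
  by congr h; apply/funext => -[[|i] ?].
- move=> c; case: WQ => _ _ /(_ [set: _]%SET (fun k => E k (c k))) ->; last first.
    by move=> k _; exact: E_events.
  under eq_bigr do rewrite PE.
  by rewrite -(big_morph EFin EFinM erefl) prodr_const cardsT exprVn.
- move=> c t ct; congr h; apply/funext => k; first exact: (ct (inl k)).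
  exact: (ct (inr k)).
Qed.

End InstanceExpectation.

(** * Limits of the mean weights and of their ratio *)

Section Limits.
Context (R : realType) (Delta : R).
Hypothesis Delta_gt0 : 0 < Delta.

Let A (N : nat) : R := mean_instance N (fhat_word Delta).
Let B (N : nat) : R := mean_instance N (fstar_word Delta).

Lemma fstar_word_size q0 s n : size s = n ->
  fstar_word Delta q0 s =
  @fstar R n.+1 (fun e => weight Delta (heavy s e)) (fun i => quantity q0 s i).
Proof. by move=> <-. Qed.

Lemma PR_mean d (T : measurableType d) (P : probability T R) N
    (W : 'I_N -> {RV P >-> R}) (Q : 'I_N.+1 -> {RV P >-> nat}) :
  @random_instance _ T R P N.+1 Delta W Q -> @PR _ T R P N.+1 W Q = A N / B N.
Proof.
move=> WQ; rewrite /PR (expectation_instance Delta_gt0 WQ (@fhat R N.+1)).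
rewrite (expectation_instance Delta_gt0 WQ (@fstar R N.+1)) /=.
by congr (_ / _); rewrite /mean_instance /mean_bool; congr ((_ + _) / _);
  apply: eq_mean_word => s <-.
Qed.

Lemma weight_ge0 b : 0 <= weight Delta b.
Proof. by rewrite /weight; case: b => //; rewrite addr_ge0// ltW. Qed.

Lemma fstar_word_ge0 q0 s : 0 <= fstar_word Delta q0 s.
Proof.
rewrite [leLHS](_ : 0 = path_weight (size s) (fun e => weight Delta (heavy s e)) (fun=> 0%N)).
  apply: fstar_ge => [e|]; first exact: weight_ge0.
  by split=> // -[].
by rewrite /path_weight big1// => e _; rewrite mulr0.
Qed.

(** The letter [a] stands for the joining edge, and [a.2] for the quantity of the first user of the
    second path. *)
Lemma fstar_word_cat q0 s a t :
  fstar_word Delta q0 s + fstar_word Delta a.2 t <= fstar_word Delta q0 (s ++ a :: t).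
Proof.
rewrite (@fstar_word_size _ (s ++ a :: t) (size s + (size t).+1)); last first.
  by rewrite size_cat.
pose w e := weight Delta (heavy (s ++ a :: t) e); pose q := quantity q0 (s ++ a :: t).
apply: le_trans (@fstar_superadditive R (size s) (size t) w q _); last first.
  by move=> e; exact: weight_ge0.
rewrite le_eqVlt; apply/orP; left; apply/eqP; congr (_ + _).
- congr fstar; apply/funext => -[i /= i_lt].
    by rewrite /w /heavy nth_cat i_lt.
  by case: i i_lt => // i i_lt; rewrite /q /quantity nth_cat (i_lt : (i < size s)%N).
- congr fstar; apply/funext => -[i /= _].
    by rewrite /w /heavy nth_cat addSnnS ltnNge leq_addr /= addKn.
  rewrite /q /quantity addSn nth_cat ltnNge leq_addr /= addKn.
  by case: i.
Qed.

Lemma B_superadditive N M : B N + B M <= B (N + M.+1)%N.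
Proof.
rewrite /B /mean_instance /mean_bool !mean_word_cat.
pose F q0 a := fstar_word Delta q0 a.
have H q0 : mean_word N (F q0) + mean_instance M F <=
    mean_word N (fun s => mean_word M.+1 (fun t => F q0 (s ++ t))).
  rewrite -(mean_word_cst N (mean_instance M F)) -mean_wordD.
  apply: ler_mean_word => s _.
  have E a : F q0 s + mean_word M (F a.2) <= mean_word M (fun t => F q0 (s ++ a :: t)).
    rewrite -[X in X + _](mean_word_cst M) -mean_wordD.
    by apply: ler_mean_word => t _; exact: fstar_word_cat.
  (* Averaging over the joining letter leaves a uniform [a.2], which plays the part of the first
     quantity in [mean_instance M F]. *)
  rewrite /= /mean_letter /mean_instance /mean_bool.
  have := E (false, false); have := E (false, true).
  have := E (true, false); have := E (true, true); rewrite /=; lra.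
have := H false; have := H true; rewrite /mean_instance /mean_bool /F; lra.
Qed.

Lemma A_rate : exists C, forall N, `|A N - N%:R * rate 1 Delta| <= C.
Proof.
have [C HC] := mean_value_rate 1 Delta; exists C => N; rewrite (le_trans _ (HC N))//.
rewrite /A (_ : fhat_word Delta = fun q0 => value (fun h => 1 + Delta * h%:R) (q0.+1, q0.+1))//.
apply/funext => q0; apply/funext => s; rewrite fhat_wordE//; congr value.
by apply/funext => -[]; rewrite /weight ?mulr1 ?mulr0 ?addr0.
Qed.

(** This is the mean of [fstar_word_le]: half of 3/2 for each user, and the heavy rate 17/38 for
    each edge. *)
Lemma B_le : exists C, forall N, B N <= 3 / 4 * N.+1%:R + Delta * (17 / 38 * N%:R + C).
Proof.
have [C HC] := mean_value_rate (0 : R) 1; exists C => N.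
pose V (q0 : bool) := value (fun h => 0 + 1 * h%:R : R) (q0.+1, q0.+1).
pose S (q0 : bool) s : R := (\sum_(i < N.+1) quantity q0 s i)%:R.
apply: (@le_trans _ _ (mean_instance N (fun q0 s => 2^-1 * S q0 s + Delta * V q0 s))).
  apply: ler_mean_instance => q0 s sN; apply: le_trans (fstar_word_le q0 s Delta_gt0) _.
  rewrite [X in X + _]mulrC sN /V.
  rewrite (_ : (fun b : bool => b%:R : R) = fun b => 0 + 1 * b%:R)//.
  by apply/funext => b; rewrite add0r mul1r.
have -> : mean_instance N (fun q0 s => 2^-1 * S q0 s + Delta * V q0 s) =
    2^-1 * mean_instance N S + Delta * mean_instance N V.
  by rewrite /mean_instance /mean_bool !mean_wordD !mean_wordZ; lra.
rewrite mean_quantity; apply: lerD; first by lra.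
rewrite ler_wpM2l ?(ltW Delta_gt0)//.
have := HC N; rewrite ler_norml /rate -/V mul0r add0r mul1r; lra.
Qed.

Lemma cvg_rate (u : nat -> R) (r C : R) : (forall N, `|u N - N%:R * r| <= C) ->
  (fun N => u N / N.+1%:R) @ \oo --> r.
Proof.
move=> uC; apply/cvgrPdist_le => e e0; near=> N.
have N0 : 0 < N.+1%:R :> R by rewrite ltr0n.
have -> : r - u N / N.+1%:R = - ((u N - N%:R * r) - r) / N.+1%:R.
  by rewrite -natr1; field; rewrite natr1 gt_eqF.
rewrite mulNr normrN normrM normfV [X in _ / X]gtr0_norm// ler_pdivrMr//.
apply: le_trans (ler_normB _ _) _; apply: le_trans (lerD (uC N) (lexx _)) _.
rewrite mulrC -ler_pdivrMr//.
apply: (@le_trans _ _ N%:R); last by rewrite ler_nat.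
by near: N; exact: nbhs_infty_ger.
Unshelve. all: by end_near.
Qed.

Lemma rate_gt0 : 0 < rate 1 Delta.
Proof. by rewrite addr_gt0 ?mulr_gt0// divr_gt0. Qed.

Lemma cvg_PR_mean : exists2 l, (fun N => A N / B N) @ \oo --> l & ratio_bound Delta <= l.
Proof.
have [CA HA] := A_rate; have [CB HB] := B_le.
have cA := cvg_rate HA.
(* Superadditivity holds in the number of users, whereas [B] is indexed by the number of edges. *)
pose c n := if n is N.+1 then B N else 0.
have B0 N : 0 <= B N.
  rewrite -[leLHS](_ : mean_instance N (fun _ _ => 0) = 0).
    by apply: ler_mean_instance => q0 s _; exact: fstar_word_ge0.
  by rewrite /mean_instance /mean_bool !mean_word_cst addr0 mul0r.
have c0 n : 0 <= c n by case: n => /=.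
have cD m n : c m + c n <= c (m + n)%N.
  case: m => [|m]; first by rewrite add0r.
  case: n => [|n]; first by rewrite addr0 addn0.
  exact: B_superadditive.
have cK n : c n <= (3 / 4 + Delta * (17 / 38 + `|CB|)) * n%:R.
  case: n => [|n]; first by rewrite mulr0.
  apply: le_trans (HB n) _; rewrite [leRHS]mulrDl lerD2l -[leRHS]mulrA ler_wpM2l ?(ltW Delta_gt0)//.
  rewrite [leRHS]mulrDl lerD//; first by rewrite ler_wpM2l ?ler_nat//; lra.
  by rewrite (le_trans (ler_norm _))// ler_peMr// ler1n.
have /cvg_ex[L cL] := fekete cD c0 cK.
have {}cL : (fun N => B N / N.+1%:R) @ \oo --> L.
  by move: cL; rewrite -cvg_shiftS.
(* The greedy rate bounds [L] away from 0, so the quotient of the limits makes sense. *)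
have rL : rate 1 Delta <= L.
  apply: (ler_cvg_to cA cL); near=> N; rewrite ler_pM2r ?invr_gt0 ?ltr0n//.
  by apply: ler_mean_instance => q0 s _; exact: fhat_word_le_fstar_word.
have L0 : 0 < L := lt_le_trans rate_gt0 rL.
have LU : L <= 3 / 4 + Delta * (17 / 38).
  have cU : (fun N => (3 / 4 * N.+1%:R + Delta * (17 / 38 * N%:R + CB)) / N.+1%:R)
      @ \oo --> 3 / 4 + Delta * (17 / 38).
    apply: (@cvg_rate _ _ `|3 / 4 + Delta * CB|) => N; rewrite le_eqVlt.
    by apply/orP; left; apply/eqP; congr `|_|; rewrite -natr1; ring.
  apply: (ler_cvg_to cL cU); near=> N.
  by rewrite ler_pM2r ?invr_gt0 ?ltr0n.
exists (rate 1 Delta / L).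
  have -> : (fun N => A N / B N) = (fun N => (A N / N.+1%:R) / (B N / N.+1%:R)).
    have divc (x y z : R) : z != 0 -> x / y = x / z / (y / z).
      by move=> z0; rewrite invf_div mulrA divfK.
    by apply/funext => N; apply: divc; rewrite pnatr_eq0.
  by apply: cvgM => //; apply: cvgV => //; rewrite gt_eqF.
(* Coefficients are compared: 604/1000 <= 232/361 and 433/1000 <= 17/38 in the numerators, 17/38 <=
   1/2 in the denominators. *)
have := Delta_gt0; rewrite /ratio_bound ler_pdivlMr// => D0.
rewrite mulrAC ler_pdivrMr; last by lra.
move: LU rL; rewrite /rate; nra.
Unshelve. all: by end_near.
Qed.

End Limits.

(** * The bound as a function of [Delta] *)

Lemma ratio_bound_increasing (R : realType) (x y : R) :
  0 < x -> x < y -> ratio_bound x < ratio_bound y.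
Proof.
move=> x0 xy; rewrite /ratio_bound ltr_pdivrMr; last by lra.
rewrite [ltRHS]mulrAC ltr_pdivlMr; last by lra.
(* The two sides differ by [y - x] times 433/1000 * 75/100 - 604/1000 * 1/2, which is positive. *)
nra.
Qed.

(** Both coefficients dominate: 604/1000 > 805/1000 * 75/100 and 433/1000 > 805/1000 * 1/2. *)
Lemma ratio_bound_gt (R : realType) (x : R) : 0 <= x -> 805 / 1000 < ratio_bound x.
Proof. by move=> x0; rewrite /ratio_bound ltr_pdivlMr; lra. Qed.

Lemma cvg_ratio_bound (R : realType) : ratio_bound x @[x --> (0 : R)^'+] --> ratio_bound (0 : R).
Proof.
apply: cvg_at_right_filter; rewrite /ratio_bound.
have cvg_affine (a b : R) : (a + b * x) @[x --> (0 : R)] --> a + b * 0.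
  by apply: cvgD; [exact: cvg_cst|apply: cvgMr; exact: cvg_id].
apply: cvgM; first exact: cvg_affine.
by apply: cvgV; [rewrite mulr0 addr0 gt_eqF// divr_gt0|exact: cvg_affine].
Qed.

Theorem proposition13 (R : realType) :
  (forall Delta : R, 0 < Delta ->
     forall (d : nat -> measure_display) (T : forall n, measurableType (d n))
            (P : forall n, probability (T n) R)
            (W : forall n, 'I_n.-1 -> {RV (P n) >-> R})
            (Q : forall n, 'I_n -> {RV (P n) >-> nat}),
       (forall n, random_instance Delta (W n) (Q n)) ->
       cvgn (fun n => PR (W n) (Q n)) /\
       ratio_bound Delta <= limn (fun n => PR (W n) (Q n))) /\
  (forall Delta Delta' : R, 0 < Delta -> Delta < Delta' ->
     ratio_bound Delta < ratio_bound Delta') /\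
  (forall Delta : R, 0 < Delta -> 805 / 1000 < ratio_bound Delta) /\
  (exists2 l : R, ratio_bound Delta @[Delta --> 0^'+] --> l & 805 / 1000 < l).
Proof.
split; [|split; [|split]].
- move=> Delta Delta0 d T P W Q WQ.
  have [l cl bl] := cvg_PR_mean Delta0.
  have cPR : (fun n => PR (W n) (Q n)) @ \oo --> l.
    (* Dropping the empty network leaves [N.+1] users and exactly [N] edges. *)
    rewrite -cvg_shiftS /=.
    under eq_fun => N do rewrite (@PR_mean _ _ Delta0 _ _ _ N _ _ (WQ N.+1)).
    exact: cl.
  by split; [apply/cvg_ex; exists l|rewrite (cvg_lim _ cPR)].
- exact: ratio_bound_increasing.
- by move=> Delta /ltW; exact: ratio_bound_gt.
- by exists (ratio_bound 0); [exact: cvg_ratio_bound|exact: ratio_bound_gt].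
Qed.
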